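(* Each nonzero object of $\mathcal C$ possesses a unique HN filtration. When HN filtrations are reindexed by slopes, forming the HN filtration is functorial: for all nonzero objects $X,Y$ of $\mathcal C$, every morphism $f\colon X\to Y$ in $\mathcal C$ and every slope $\mu\in V\otimes_{\mathbf Z}\mathbf Q$, the restriction of $f$ to $X^{(\mu)}$ factors (canonically) through $Y^{(\mu)}$.
   Context: Setting and standing assumptions. $V$ is a totally ordered abelian group (written additively); $\mathcal C$ is an exact category, whose distinguished short exact sequences are called short strict exact sequences, and whose admissible monomorphisms/epimorphisms are called strict monomorphisms/epimorphisms; a subobject is strict if its inclusion is a strict monomorphism (and then the quotient $X/X'$ is formed via the corresponding short strict exact sequence); $\mathcal D$ is an abelian category; $F\colon\mathcal C\to\mathcal D$ is a functor; $\mathrm{rk}$ is a function from isomorphism classes of objects of $\mathcal D$ to $\mathbf Z_{\ge 0}$; $\deg$ is a function from isomorphism classes of objects of $\mathcal C$ to $V$. One assumes: (i) $F$ is exact and faithful, and for each object $X$ of $\mathcal C$, $F$ induces a bijection from strict subobjects of $X$ to subobjects of $F(X)$; (ii) $\mathrm{rk}$ is additive over short exact sequences, and for each object $X$ of $\mathcal D$, $\mathrm{rk}\,X=0$ if and only if $X=0$; (iii) $\deg$ is additive over short strict exact sequences, and for each morphism $f\colon X\to Y$ of $\mathcal C$ with $F(f)$ an isomorphism, $\deg(X)\le\deg(Y)$, with equality if and only if $f$ is an isomorphism. For $X$ in $\mathcal C$ write $\mathrm{rk}(X)=\mathrm{rk}(F(X))$. Elements of $V\otimes_{\mathbf Z}\mathbf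 Q$ (with the total order extending that of $V$) are called slopes; a nonzero object $X$ of $\mathcal C$ has slope $\mu(X)=\deg(X)/\mathrm{rk}(X)\in V\otimes_{\mathbf Z}\mathbf Q$. A nonzero object $X$ of $\mathcal C$ is semistable if $\mu(X')\le\mu(X)$ for all nonzero proper subobjects $X'$ of $X$. An HN filtration of a nonzero object $X$ is a finite filtration by strict subobjects $0=X_0\subsetneq X_1\subsetneq\cdots\subsetneq X_N=X$ such that each $\mathrm{Gr}_i=X_i/X_{i-1}$ is semistable and $\mu(\mathrm{Gr}_{i+1})<\mu(\mathrm{Gr}_i)$ for each $i$. Write $\mu_i=\mu(\mathrm{Gr}_i)$. The reindexing by slopes is: for a slope $\mu$, $X^{(\mu)}=X_N=X$ if $\mu\le\mu_N$; $X^{(\mu)}=X_i$ if $\mu_{i+1}<\mu\le\mu_i$ (for $1\le i<N$); and $X^{(\mu)}=0$ if $\mu>\mu_1$. *)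

(* Defs.v *)
From HB Require Import structures.
From mathcomp Require Import all_boot all_order all_algebra.
From mathcomp Require Import generic_quotient zify ring.

Set Implicit Arguments.
Unset Strict Implicit.
Unset Printing Implicit Defensive.

Import Order.TTheory GRing.Theory Num.Theory.
Local Open Scope ring_scope.

HB.mixin Record isTotallyOrderedGroup V of Num.POrderedZmodule V := {
  og_total : forall x y : V, (x <= y) || (y <= x);
  og_leD2l : forall z x y : V, x <= y -> z + x <= z + y
}.

#[short(type="orderedGroupType")]
HB.structure Definition TotallyOrderedGroup :=
  { V of Num.POrderedZmodule V & isTotallyOrderedGroup V }.

Section OrderedGroupTheory.
Variable V : orderedGroupType.
Implicit Types x y z : V.

Lemma og_leD x y z t : x <= y -> z <= t -> x + z <= y + t.
Proof.
move=> xy zt; apply: (le_trans (y := x + t)); first exact: og_leD2l.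
by rewrite ![_ + t]addrC og_leD2l.
Qed.

Lemma og_leBl z x y : z + x <= z + y -> x <= y.
Proof. by move=> /(og_leD2l (- z)); rewrite !addKr. Qed.

Lemma og_leMn n x y : (0 < n)%N -> (x *+ n <= y *+ n) = (x <= y).
Proof.
have leMn m u v : u <= v -> u *+ m <= v *+ m :> V.
  by move=> uv; elim: m => // m IHm; rewrite !mulrS og_leD.
case: n => // n _; apply/idP/idP => [|/leMn //].
have /orP[//|yx] := og_total x y.
by rewrite !mulrS => h; apply: (@og_leBl (x *+ n)); rewrite addrC
  (le_trans h)// addrC og_leD // leMn.
Qed.

Lemma og_mulIn n : (0 < n)%N -> injective (fun x : V => x *+ n).
Proof.
by move=> n0 x y e; apply/eqP; rewrite eq_le -(og_leMn x y n0)
  -(og_leMn y x n0) e lexx.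
Qed.

End OrderedGroupTheory.

(* V ⊗_Z Q is realised as the group of fractions v / n (v in V, n > 0); the
   pair (v, n) encodes v / n.+1.  [tensQ_universal] below is the universal
   property of the tensor product, and [tensQ_le] together with the
   orderedGroupType instance says that the order is the (unique) group order
   extending that of V. *)
Section TensorQ.
Variable V : orderedGroupType.

Definition tensQ_eq (x y : V * nat) := x.1 *+ y.2.+1 == y.1 *+ x.2.+1.

Lemma tensQ_eq_refl : reflexive tensQ_eq.
Proof. by move=> x; rewrite /tensQ_eq. Qed.

Lemma tensQ_eq_sym : symmetric tensQ_eq.
Proof. by move=> x y; rewrite /tensQ_eq eq_sym. Qed.

Lemma tensQ_eq_trans : transitive tensQ_eq.
Proof.
move=> [y m] [x n] [z p]; rewrite /tensQ_eq /= => /eqP xy /eqP yz.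
apply/eqP/(og_mulIn (ltn0Sn m)).
by rewrite mulrnAC xy mulrnAC yz mulrnAC.
Qed.

Canonical tensQ_equiv :=
  EquivRel tensQ_eq tensQ_eq_refl tensQ_eq_sym tensQ_eq_trans.

Definition tensQ := {eq_quot tensQ_eq}%qT.
HB.instance Definition _ := Choice.on tensQ.
HB.instance Definition _ : EqQuotient _ tensQ_eq tensQ := EqQuotient.on tensQ.

Definition fracQ (v : V) (n : nat) : tensQ := (\pi_tensQ (v, n.-1))%qT.
Definition numQ (a : tensQ) : V := (repr a).1.
Definition denQ (a : tensQ) : nat := (repr a).2.+1.

Lemma fracQK a : fracQ (numQ a) (denQ a) = a.
Proof. by rewrite /fracQ /= -surjective_pairing reprK. Qed.

Lemma eq_fracQ v n w m : (0 < n)%N -> (0 < m)%N ->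
  (fracQ v n == fracQ w m) = (v *+ m == w *+ n).
Proof. by case: n m => [//|n] [//|m] _ _; rewrite /fracQ eqmodE. Qed.

Lemma fracQP v n w m : (0 < n)%N -> (0 < m)%N ->
  fracQ v n = fracQ w m <-> v *+ m = w *+ n.
Proof. by move=> n0 m0; split=> /eqP h; apply/eqP; move: h; rewrite eq_fracQ. Qed.

Lemma numdenQ v n : (0 < n)%N ->
  numQ (fracQ v n) *+ n = v *+ denQ (fracQ v n).
Proof. by move=> n0; apply/fracQP => //; rewrite fracQK. Qed.

Lemma tensQW (P : tensQ -> Prop) :
  (forall v n, (0 < n)%N -> P (fracQ v n)) -> forall a, P a.
Proof. by move=> h a; rewrite -(fracQK a); apply: h. Qed.

Definition addQ a b :=
  fracQ (numQ a *+ denQ b + numQ b *+ denQ a) (denQ a * denQ b).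
Definition oppQ a := fracQ (- numQ a) (denQ a).
Definition leQ a b := numQ a *+ denQ b <= numQ b *+ denQ a.
Definition ltQ a b := (b != a) && leQ a b.

Lemma addQE v n w m : (0 < n)%N -> (0 < m)%N ->
  addQ (fracQ v n) (fracQ w m) = fracQ (v *+ m + w *+ n) (n * m).
Proof.
move=> n0 m0; apply/fracQP; rewrite ?muln_gt0 ?n0 //.
have := numdenQ w m0; have := numdenQ v n0.
move: (denQ (fracQ v n)) (numQ (fracQ v n)) => d x.
move: (denQ (fracQ w m)) (numQ (fracQ w m)) => d' x' e e'.
rewrite !mulrnDl -!mulrnA; congr (_ + _).
  have -> : (d' * (n * m) = n * (d' * m))%N by lia.
  by rewrite mulrnA e -mulrnA; congr (_ *+ _); lia.
have -> : (d * (n * m) = m * (d * n))%N by lia.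
by rewrite mulrnA e' -mulrnA; congr (_ *+ _); lia.
Qed.

Lemma oppQE v n : (0 < n)%N -> oppQ (fracQ v n) = fracQ (- v) n.
Proof. by move=> n0; apply/fracQP => //; rewrite !mulNrn numdenQ. Qed.

Lemma leQE v n w m : (0 < n)%N -> (0 < m)%N ->
  leQ (fracQ v n) (fracQ w m) = (v *+ m <= w *+ n).
Proof.
move=> n0 m0; rewrite /leQ.
have [d0 d'0] : (0 < denQ (fracQ v n))%N /\ (0 < denQ (fracQ w m))%N by [].
have := numdenQ w m0; have := numdenQ v n0; move: d0 d'0.
move: (denQ (fracQ v n)) (numQ (fracQ v n)) => d x.
move: (denQ (fracQ w m)) (numQ (fracQ w m)) => d' x' d0 d'0 e e'.
rewrite -(@og_leMn _ (n * m)) ?muln_gt0 ?n0 //.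
rewrite -[RHS](@og_leMn _ (d * d')) ?muln_gt0 ?d0 //.
rewrite -!mulrnA.
have -> : (d' * (n * m) = n * (d' * m))%N by lia.
have -> : (d * (n * m) = m * (d * n))%N by lia.
rewrite [in LHS]mulrnA e mulrnA [X in _ <= X]mulrnA e' -!mulrnA.
by congr (_ *+ _ <= _ *+ _); lia.
Qed.

Fact addQA : associative addQ.
Proof.
elim/tensQW=> u n n0; elim/tensQW=> v m m0; elim/tensQW=> w p p0.
rewrite !addQE ?muln_gt0 ?n0 ?m0 // mulnA; congr (fracQ _ _).
by rewrite !mulrnDl -!mulrnA addrA; congr (_ + _ *+ _ + _ *+ _); lia.
Qed.

Fact addQC : commutative addQ.
Proof. by move=> a b; rewrite /addQ addrC mulnC. Qed.

Fact add0Q : left_id (fracQ 0 1) addQ.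
Proof. by elim/tensQW=> v n n0; rewrite addQE // mul0rn add0r mul1n. Qed.

Fact addNQ : left_inverse (fracQ 0 1) oppQ addQ.
Proof.
elim/tensQW=> v n n0; rewrite oppQE // addQE //.
by apply/fracQP; rewrite ?muln_gt0 ?n0 // mulNrn addNr !mul0rn.
Qed.

HB.instance Definition _ := GRing.isZmodule.Build tensQ addQA addQC add0Q addNQ.

Fact leQ_anti : antisymmetric leQ.
Proof.
elim/tensQW=> u n n0; elim/tensQW=> v m m0; rewrite !leQE // => h.
by apply/fracQP=> //; apply/le_anti.
Qed.

Fact leQ_trans : transitive leQ.
Proof.
elim/tensQW=> v m m0; elim/tensQW=> u n n0; elim/tensQW=> w p p0.
rewrite !leQE // -(og_leMn (n := p)) // => uv.
rewrite -(og_leMn (n := n)) // => vw.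
rewrite -(og_leMn (n := m)) //; apply: le_trans (_ : u *+ m *+ p <= _).
  by rewrite -!mulrnA mulnC.
by apply: le_trans uv _; rewrite mulrnAC (le_trans vw)// mulrnAC.
Qed.

Fact leQ_total : total leQ.
Proof. by move=> a b; apply: og_total. Qed.

HB.instance Definition _ := Order.isOrder.Build ring_display tensQ
  (fun _ _ => erefl) (fun _ _ => erefl) (fun _ _ => erefl)
  leQ_anti leQ_trans leQ_total.

Lemma add_fracQ v n w m : (0 < n)%N -> (0 < m)%N ->
  fracQ v n + fracQ w m = fracQ (v *+ m + w *+ n) (n * m).
Proof. exact: addQE. Qed.

Lemma le_fracQ v n w m : (0 < n)%N -> (0 < m)%N ->
  (fracQ v n <= fracQ w m) = (v *+ m <= w *+ n).
Proof. exact: leQE. Qed.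

Fact leQ_add2l (c a b : tensQ) : a <= b -> c + a <= c + b.
Proof.
elim/tensQW: c => w p p0; elim/tensQW: a => u n n0; elim/tensQW: b => v m m0.
rewrite !add_fracQ // !le_fracQ ?muln_gt0 ?p0 // => h.
rewrite !mulrnDl -!mulrnA.
have -> : (n * (p * m) = m * (p * n))%N by lia.
apply: og_leD2l.
have -> : (p * (p * m) = m * (p * p))%N by lia.
have -> : (p * (p * n) = n * (p * p))%N by lia.
by rewrite mulrnA [X in _ <= X]mulrnA og_leMn // muln_gt0 p0.
Qed.

HB.instance Definition _ :=
  isTotallyOrderedGroup.Build tensQ leQ_total leQ_add2l.

Definition tens (v : V) (q : rat) : tensQ := fracQ (v *~ numq q) `|denq q|.

Lemma tensE v q (a : int) n :
  (0 < n)%N -> q * n%:R = a%:~R -> tens v q = fracQ (v *~ a) n.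
Proof.
move=> n0 e; apply/fracQP; rewrite ?absz_gt0 ?denq_neq0 //.
rewrite !pmulrn -!mulrzA absz_denq; congr (_ *~ _).
apply: (@intr_inj rat); rewrite !intrM numqE -e mulrAC.
by rewrite -pmulrn.
Qed.

Lemma tens_invn v n : (0 < n)%N -> tens v n%:R^-1 = fracQ v n.
Proof. by move=> n0; rewrite (@tensE v _ 1 n) ?mulVf ?pnatr_eq0 -?lt0n. Qed.

Lemma tensDl u v q : tens (u + v) q = tens u q + tens v q.
Proof.
have d0 : (0 < `|denq q|)%N by rewrite absz_gt0 denq_neq0.
rewrite /tens add_fracQ //; apply/fracQP; rewrite ?muln_gt0 ?d0 //.
by rewrite -mulrnDl -mulrzDl -mulrnA.
Qed.

Lemma tensDr v p q : tens v (p + q) = tens v p + tens v q.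
Proof.
have d0 r : (0 < `|denq r|)%N by rewrite absz_gt0 denq_neq0.
rewrite /tens add_fracQ // [LHS](@tensE v _
  (numq p * `|denq q|%N + numq q * `|denq p|%N) (`|denq p| * `|denq q|)).
- by rewrite mulrzDr !mulrzA -!pmulrn.
- by rewrite muln_gt0 !d0.
by rewrite intrD !intrM !absz_denq !numqE natrM !pmulrn !absz_denq; ring.
Qed.

Lemma tensQ_le u v : (tens u 1 <= tens v 1) = (u <= v).
Proof.
by rewrite -[1 : rat]invr1 !(@tens_invn _ 1%N) // le_fracQ // !mulr1n.
Qed.

Theorem tensQ_universal (U : zmodType) (b : V -> rat -> U) :
    (forall u v q, b (u + v) q = b u q + b v q) ->
    (forall v p q, b v (p + q) = b v p + b v q) ->
  exists2 h : tensQ -> U,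
    {morph h : x y / x + y} /\ (forall v q, h (tens v q) = b v q) &
    forall h' : tensQ -> U, {morph h' : x y / x + y} ->
      (forall v q, h' (tens v q) = b v q) -> h' =1 h.
Proof.
move=> bDl bDr.
have b0l q : b 0 q = 0 by apply: (@addrI _ (b 0 q)); rewrite -bDl !addr0.
have b0r v : b v 0 = 0 by apply: (@addrI _ (b v 0)); rewrite -bDr !addr0.
have bMl n v q : b (v *+ n) q = b v q *+ n.
  by elim: n => [|n IHn]; rewrite ?mulr0n // !mulrS bDl IHn.
have bMr n v q : b v (q *+ n) = b v q *+ n.
  by elim: n => [|n IHn]; rewrite ?mulr0n // !mulrS bDr IHn.
have bNl v q : b (- v) q = - b v q.
  by apply/eqP; rewrite -addr_eq0 -bDl addNr b0l.
have bNr v q : b v (- q) = - b v q.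
  by apply/eqP; rewrite -addr_eq0 -bDr addNr b0r.
have bZ (a : int) v q : b (v *~ a) q = b v (q *~ a).
  by case: a => n; rewrite ?NegzE ?mulrNz -!pmulrn ?bNl ?bNr bMl bMr.
have bV v n m : (0 < n)%N -> (0 < m)%N ->
    b (v *+ m) (n * m)%:R^-1 = b v n%:R^-1.
  move=> n0 m0; rewrite bMl -bMr; congr (b v _).
  by rewrite -[LHS]mulr_natr natrM invfM -mulrA mulVf ?mulr1 // pnatr_eq0 -lt0n.
pose h a := b (numQ a) (denQ a)%:R^-1.
have hE v n : (0 < n)%N -> h (fracQ v n) = b v n%:R^-1.
  move=> n0; rewrite /h -(@bV _ (denQ _) n) // numdenQ // mulnC.
  by rewrite bV.
exists h; first split.
- elim/tensQW=> u n n0; elim/tensQW=> v m m0.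
  by rewrite add_fracQ // !hE ?muln_gt0 ?n0 // bDl bV // mulnC bV.
- move=> v q; rewrite /tens hE ?absz_gt0 ?denq_neq0 // bZ; congr (b v _).
  by rewrite -mulrzl pmulrn absz_denq divq_num_den.
move=> h' _ h'E; elim/tensQW=> v n n0.
by rewrite hE // -h'E tens_invn.
Qed.

End TensorQ.

Notation "v ⊗ q" := (tens v q) (at level 40) : ring_scope.

Declare Scope cat_scope.
Delimit Scope cat_scope with cat.
Local Open Scope cat_scope.

Record preaddCat := PreaddCat {
  obj :> Type;
  Mor : obj -> obj -> zmodType;
  idm : forall A, Mor A A;
  compm : forall A B C, Mor B C -> Mor A B -> Mor A C;
  compm_idl : forall A B (f : Mor A B), compm (idm B) f = f;
  compm_idr : forall A B (f : Mor A B), compm f (idm A) = f;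
  compmA : forall A B C D (h : Mor C D) (g : Mor B C) (f : Mor A B),
    compm h (compm g f) = compm (compm h g) f;
  compmDl : forall A B C (g g' : Mor B C) (f : Mor A B),
    compm (g + g') f = compm g f + compm g' f;
  compmDr : forall A B C (g : Mor B C) (f f' : Mor A B),
    compm g (f + f') = compm g f + compm g f'
}.

Arguments Mor {p} A B.
Arguments idm {p} A.
Arguments compm {p A B C} g f.
Notation "g ∘ f" := (compm g f) (at level 40, left associativity) : cat_scope.

Section Preadditive.
Variable C : preaddCat.
Implicit Types A B X Y Z : C.

Definition is_mono A B (f : Mor A B) :=
  forall Z (g h : Mor Z A), f ∘ g = f ∘ h -> g = h.

Definition is_epi A B (f : Mor A B) :=
  forall Z (g h : Mor B Z), g ∘ f = h ∘ f -> g = h.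

Definition is_iso A B (f : Mor A B) :=
  exists g : Mor B A, g ∘ f = idm A /\ f ∘ g = idm B.

Definition isomorphic A B := exists f : Mor A B, is_iso f.

Definition is_zero A :=
  forall B, (exists! f : Mor A B, True) /\ (exists! f : Mor B A, True).

Definition is_kernel A B X (f : Mor A B) (k : Mor X A) :=
  f ∘ k = 0 /\
  forall Z (t : Mor Z A), f ∘ t = 0 -> exists! u : Mor Z X, k ∘ u = t.

Definition is_cokernel A B X (f : Mor A B) (c : Mor B X) :=
  c ∘ f = 0 /\
  forall Z (t : Mor B Z), t ∘ f = 0 -> exists! u : Mor X Z, u ∘ c = t.

(* i' : B -> P is the pushout of i : A -> X along f : A -> B. *)
Definition is_pushout A X B P
    (i : Mor A X) (f : Mor A B) (i' : Mor B P) (f' : Mor X P) :=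
  i' ∘ f = f' ∘ i /\
  forall Z (s : Mor B Z) (t : Mor X Z), s ∘ f = t ∘ i ->
    exists! u : Mor P Z, u ∘ i' = s /\ u ∘ f' = t.

(* p' : P -> B is the pullback of p : X -> A along f : B -> A. *)
Definition is_pullback A X B P
    (p : Mor X A) (f : Mor B A) (p' : Mor P B) (f' : Mor P X) :=
  f ∘ p' = p ∘ f' /\
  forall Z (s : Mor Z B) (t : Mor Z X), f ∘ s = p ∘ t ->
    exists! u : Mor Z P, p' ∘ u = s /\ f' ∘ u = t.

Definition is_biproduct A B P
    (i1 : Mor A P) (i2 : Mor B P) (p1 : Mor P A) (p2 : Mor P B) :=
  [/\ p1 ∘ i1 = idm A, p2 ∘ i2 = idm B, p1 ∘ i2 = 0, p2 ∘ i1 = 0 &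
      i1 ∘ p1 + i2 ∘ p2 = idm P].

Definition is_additive :=
  (exists Z, is_zero Z) /\
  forall A B, exists P (i1 : Mor A P) (i2 : Mor B P)
    (p1 : Mor P A) (p2 : Mor P B), is_biproduct i1 i2 p1 p2.

(* In an abelian category this says that 0 -> A -> B -> X -> 0 is exact. *)
Definition ker_coker_pair A B X (i : Mor A B) (p : Mor B X) :=
  is_kernel p i /\ is_cokernel i p.

End Preadditive.

Section ExactAxioms.
Variables (C : preaddCat)
  (E : forall A B X : C, Mor A B -> Mor B X -> Prop).
Implicit Types A B X Y : C.

Definition adm_mono A B (i : Mor A B) := exists X (p : Mor B X), E i p.
Definition adm_epi B X (p : Mor B X) := exists A (i : Mor A B), E i p.

(* Quillen's axioms, in the self-dual form given by Buehler *)
Record exact_axioms : Prop := ExactAxioms {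
  ex_ker_coker : forall A B X (i : Mor A B) (p : Mor B X),
    E i p -> ker_coker_pair i p;
  ex_iso : forall A B X A' B' X' (i : Mor A B) (p : Mor B X)
    (i' : Mor A' B') (p' : Mor B' X')
    (a : Mor A A') (b : Mor B B') (x : Mor X X'),
    is_iso a -> is_iso b -> is_iso x -> i' ∘ a = b ∘ i -> p' ∘ b = x ∘ p ->
    E i p -> E i' p';
  ex_id_mono : forall A, adm_mono (idm A);
  ex_id_epi : forall A, adm_epi (idm A);
  ex_comp_mono : forall A B X (i : Mor A B) (j : Mor B X),
    adm_mono i -> adm_mono j -> adm_mono (j ∘ i);
  ex_comp_epi : forall A B X (p : Mor A B) (q : Mor B X),
    adm_epi p -> adm_epi q -> adm_epi (q ∘ p);
  ex_pushout : forall A X B (i : Mor A X) (f : Mor A B), adm_mono i ->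
    exists P (i' : Mor B P) (f' : Mor X P),
      is_pushout i f i' f' /\ adm_mono i';
  ex_pullback : forall A X B (p : Mor X A) (f : Mor B A), adm_epi p ->
    exists P (p' : Mor P B) (f' : Mor P X),
      is_pullback p f p' f' /\ adm_epi p'
}.

End ExactAxioms.

Record exactCat := ExactCat {
  exact_base :> preaddCat;
  exact_additive : is_additive exact_base;
  strict_exact :
    forall A B X : exact_base, Mor A B -> Mor B X -> Prop;
  exactP : exact_axioms strict_exact
}.

Arguments strict_exact {e A B X} i p.

Definition strict_mono (C : exactCat) (A B : C) (i : Mor A B) :=
  adm_mono (@strict_exact C) i.

Record abelianCat := AbelianCat {
  abelian_base :> preaddCat;
  abelian_additive : is_additive abelian_base;
  abelian_ker : forall (A B : abelian_base) (f : Mor A B),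
    exists X (k : Mor X A), is_kernel f k;
  abelian_coker : forall (A B : abelian_base) (f : Mor A B),
    exists X (c : Mor B X), is_cokernel f c;
  abelian_mono : forall (A B : abelian_base) (f : Mor A B),
    is_mono f -> exists X (g : Mor B X), is_kernel g f;
  abelian_epi : forall (A B : abelian_base) (f : Mor A B),
    is_epi f -> exists X (g : Mor X A), is_cokernel g f
}.

(* A subobject of X is represented by a monomorphism; two representatives are
   the same subobject when they are related by [sub_eq]. *)
Record subobject (C : preaddCat) (X : C) := Subobject {
  sub_obj :> C;
  sub_arr : Mor sub_obj X;
  sub_mono : is_mono sub_arr
}.

Section Subobjects.
Variables (C : preaddCat) (X : C).

Definition factors_through A B (m : Mor A X) (n : Mor B X) :=
  exists u : Mor A B, n ∘ u = m.

Definition same_subobject A B (m : Mor A X) (n : Mor B X) :=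
  factors_through m n /\ factors_through n m.

Definition sub_le (s t : subobject X) :=
  factors_through (sub_arr s) (sub_arr t).
Definition sub_eq (s t : subobject X) :=
  same_subobject (sub_arr s) (sub_arr t).
Definition sub_lt (s t : subobject X) := sub_le s t /\ ~ sub_eq s t.

Definition proper_sub (s : subobject X) := ~ is_iso (sub_arr s).

End Subobjects.

Definition strict_sub (C : exactCat) (X : C) (s : subobject X) :=
  strict_mono (sub_arr s).

Record functor (C D : preaddCat) := Functor {
  fobj :> C -> D;
  fmap : forall A B : C, Mor A B -> Mor (fobj A) (fobj B);
  fmap_id : forall A : C, fmap (idm A) = idm (fobj A);
  fmap_comp : forall (A B X : C) (g : Mor B X) (f : Mor A B),
    fmap (g ∘ f) = fmap g ∘ fmap f
}.

Arguments fmap {C D} f0 {A B} f.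

Definition faithful_functor (C D : preaddCat) (F : functor C D) :=
  forall (A B : C) (f g : Mor A B), fmap F f = fmap F g -> f = g.

Section FunctorConditions.
Variables (C : exactCat) (D : abelianCat) (F : functor C D).

(* Additivity of F is a consequence: the split sequences A -> A + B -> B are
   short strict exact, so F preserves biproducts. *)
Definition exact_functor :=
  forall (A B X : C) (i : Mor A B) (p : Mor B X),
    strict_exact i p -> ker_coker_pair (fmap F i) (fmap F p).

(* Injectivity and surjectivity of s |-> F s from strict subobjects of X to
   subobjects of F X. *)
Definition strict_sub_bijection (X : C) :=
  (forall s t : subobject X, strict_sub s -> strict_sub t ->
     same_subobject (fmap F (sub_arr s)) (fmap F (sub_arr t)) ->
     sub_eq s t) /\
  (forall t : subobject (F X), exists2 s : subobject X, strict_sub s &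
     same_subobject (fmap F (sub_arr s)) (sub_arr t)).

End FunctorConditions.

(* deg X / rk X; the value at an object of rank 0 is the junk value 0. *)
Definition slope (V : orderedGroupType) (C D : preaddCat) (F : functor C D)
    (rk : D -> nat) (deg : C -> V) (X : C) : tensQ V :=
  deg X ⊗ (rk (F X))%:R^-1.

Section HarderNarasimhan.
Variables (V : orderedGroupType) (C : exactCat) (mu : C -> tensQ V).

(* The subobjects s are arbitrary, not only strict ones. *)
Definition semistable (X : C) :=
  ~ is_zero X /\
  forall s : subobject X, ~ is_zero s -> proper_sub s -> mu s <= mu X.

(* Only the values hn_fil 0, ..., hn_fil hn_len and hn_gr 1, ..., hn_gr hn_len
   are meaningful; hn_gr i is the quotient Gr_i of hn_fil i by its strict
   subobject hn_fil i.-1. *)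
Record HN_filtration (X : C) := HNFiltration {
  hn_len : nat;
  hn_fil : nat -> subobject X;
  hn_gr : nat -> C;
  hn_strict : forall i, (i <= hn_len)%N -> strict_sub (hn_fil i);
  hn_bot : is_zero (hn_fil 0%N);
  hn_top : is_iso (sub_arr (hn_fil hn_len));
  hn_lt : forall i, (i < hn_len)%N -> sub_lt (hn_fil i) (hn_fil i.+1);
  hn_quot : forall i, (i < hn_len)%N ->
    exists (j : Mor (hn_fil i) (hn_fil i.+1))
           (p : Mor (hn_fil i.+1) (hn_gr i.+1)),
      sub_arr (hn_fil i.+1) ∘ j = sub_arr (hn_fil i) /\ strict_exact j p;
  hn_semistable : forall i, (0 < i <= hn_len)%N -> semistable (hn_gr i);
  hn_slope : forall i, (0 < i < hn_len)%N ->
    mu (hn_gr i.+1) < mu (hn_gr i)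
}.

Definition same_HN_filtration (X : C) (H H' : HN_filtration X) :=
  hn_len H = hn_len H' /\
  forall i, (i <= hn_len H)%N -> sub_eq (hn_fil H i) (hn_fil H' i).

Section Reindexing.
Variables (X : C) (H : HN_filtration X).
Let N := hn_len H.
Let mu_ i := mu (hn_gr H i).

(* The index i with X^(t) = X_i.  For X nonzero, so that N > 0, the last
   branch is reached only if mu_N < t <= mu_1, and then the pick succeeds for
   exactly one i since the mu_i are strictly decreasing. *)
Definition hn_index (t : tensQ V) : nat :=
  if t <= mu_ N then N
  else if mu_ 1 < t then 0%N
  else if [pick i : 'I_N | (0 < i)%N && (mu_ i.+1 < t <= mu_ i)] is Some i
       then i : nat else 0%N.

Definition hn_at (t : tensQ V) : subobject X := hn_fil H (hn_index t).

End Reindexing.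

End HarderNarasimhan.

(* Main.v *)
(* F identifies the coimage of a morphism of C with its strict image, so slopes
   grow from the coimage to the image.  Hence a map between semistable objects
   of decreasing slope vanishes.  Functoriality follows by moving one step at a
   time along both filtrations, and uniqueness by comparing two filtrations
   through the identity.  For existence, degrees need not be bounded a priori:
   a destabilizing strict subobject S of minimal rank has no nonzero map to a
   semistable object of slope at most mu(X), and induction on X/S produces the
   last quotient of the filtration of X. *)

Require Import Defs.
From mathcomp Require Import all_boot all_order all_algebra.
From mathcomp Require Import zify.
From Stdlib Require Import Classical.

Set Implicit Arguments.
Unset Strict Implicit.
Unset Printing Implicit Defensive.

Import Order.TTheory GRing.Theory Num.Theory.
Local Open Scope ring_scope.
Local Open Scope cat_scope.

(** * Cancellation in ordered groups and choice of minimal elements *)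

Lemma og_leD2lE (U : orderedGroupType) (z x y : U) :
  (z + x <= z + y) = (x <= y).
Proof. by apply/idP/idP; [apply: og_leBl | apply: og_leD2l]. Qed.

(** Descent on [f x]. It serves to pick strict quotients and strict subobjects of minimal rank. *)
Lemma exists_minimal (T : Type) (f : T -> nat) (P : T -> Prop) :
  (exists x, P x) -> exists2 x, P x & forall y, P y -> (f x <= f y)%N.
Proof.
case=> x Px; have [n le_fx_n] := ubnP (f x).
elim: n => // n IHn in x Px le_fx_n *.
have [[y [Py lt_fy_fx]]|min_x] := classic (exists y, P y /\ (f y < f x)%N).
  by apply: (IHn y Py); apply: leq_trans lt_fy_fx _.
exists x => // y Py; rewrite leqNgt; apply/negP => lt_fy_fx.
by apply: min_x; exists y.
Qed.

(** * Preadditive, abelian and exact categories *)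

Section PreadditiveTheory.
Variable C : preaddCat.
Implicit Types A B X Y Z : C.

Lemma compm0 A B X (g : Mor B X) : g ∘ (0 : Mor A B) = 0.
Proof. by apply: (@addrI _ (g ∘ 0)); rewrite -compmDr !addr0. Qed.

Lemma comp0m A B X (f : Mor A B) : (0 : Mor B X) ∘ f = 0.
Proof. by apply: (@addrI _ (0 ∘ f)); rewrite -compmDl !addr0. Qed.

Lemma is_zeroP A : is_zero A <-> idm A = 0.
Proof.
split=> [zA|id0 B].
  by have [[f [_ uf]] _] := zA A; rewrite -(uf (idm A)) // (uf 0).
split; exists 0; split=> // f _.
  by rewrite -[f]compm_idr id0 compm0.
by rewrite -[f]compm_idl id0 comp0m.
Qed.

Lemma mor_from_zero A B (f : Mor A B) : is_zero A -> f = 0.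
Proof. by move/is_zeroP=> zA; rewrite -[f]compm_idr zA compm0. Qed.

Lemma mor_to_zero A B (f : Mor A B) : is_zero B -> f = 0.
Proof. by move/is_zeroP=> zB; rewrite -[f]compm_idl zB comp0m. Qed.

Lemma mono0_zero A B (f : Mor A B) : is_mono f -> f = 0 -> is_zero A.
Proof. by move=> mf f0; apply/is_zeroP/mf; rewrite f0 !comp0m. Qed.

Lemma epi0_zero A B (f : Mor A B) : is_epi f -> f = 0 -> is_zero B.
Proof. by move=> ef f0; apply/is_zeroP/ef; rewrite f0 !compm0. Qed.

Lemma is_iso_idm A : is_iso (idm A).
Proof. by exists (idm A); rewrite compm_idl. Qed.

Lemma is_iso_mono A B (f : Mor A B) : is_iso f -> is_mono f.
Proof.
move=> [g [gf _]] Z u v e.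
by rewrite -[u]compm_idl -[v]compm_idl -gf -!compmA e.
Qed.

Lemma is_iso_epi A B (f : Mor A B) : is_iso f -> is_epi f.
Proof.
move=> [g [_ fg]] Z u v e.
by rewrite -[u]compm_idr -[v]compm_idr -fg !compmA e.
Qed.

Lemma comp_mono A B X (f : Mor A B) (g : Mor B X) :
  is_mono f -> is_mono g -> is_mono (g ∘ f).
Proof. by move=> mf mg Z u v; rewrite -!compmA => /mg /mf. Qed.

Lemma comp_epi A B X (f : Mor A B) (g : Mor B X) :
  is_epi f -> is_epi g -> is_epi (g ∘ f).
Proof. by move=> ef eg Z u v; rewrite !compmA => /ef /eg. Qed.

Lemma idm_mono A : is_mono (idm A).
Proof. exact/is_iso_mono/is_iso_idm. Qed.

Lemma kernel_mono A B X (f : Mor A B) (k : Mor X A) :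
  is_kernel f k -> is_mono k.
Proof.
move=> [fk ker] Z u v e.
have [|w [_ uw]] := ker Z (k ∘ u); first by rewrite compmA fk comp0m.
by rewrite -(uw u) // (uw v).
Qed.

Lemma cokernel_epi A B X (f : Mor A B) (c : Mor B X) :
  is_cokernel f c -> is_epi c.
Proof.
move=> [cf coker] Z u v e.
have [|w [_ uw]] := coker Z (u ∘ c); first by rewrite -compmA cf compm0.
by rewrite -(uw u) // (uw v).
Qed.

Lemma kernel_lift A B X (f : Mor A B) (k : Mor X A) Z (t : Mor Z A) :
  is_kernel f k -> f ∘ t = 0 -> exists u, k ∘ u = t.
Proof. by move=> [_ ker] /ker [u [ku _]]; exists u. Qed.

Lemma cokernel_lift A B X (f : Mor A B) (c : Mor B X) Z (t : Mor B Z) :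
  is_cokernel f c -> t ∘ f = 0 -> exists u, u ∘ c = t.
Proof. by move=> [_ coker] /coker [u [uc _]]; exists u. Qed.

Lemma factor_iso X A B (m : Mor A X) (n : Mor B X) (u : Mor A B) :
  is_mono m -> is_mono n -> n ∘ u = m -> factors_through n m -> is_iso u.
Proof.
move=> mm mn nu [v mv]; exists v; split.
  by apply: mm; rewrite compmA mv nu compm_idr.
by apply: mn; rewrite compmA nu mv compm_idr.
Qed.

Lemma factors_through_trans X A B A' (m : Mor A X) (n : Mor B X)
    (l : Mor A' X) :
  factors_through m n -> factors_through n l -> factors_through m l.
Proof. by move=> [u <-] [v <-]; exists (v ∘ u); rewrite compmA. Qed.

Lemma same_subobject_sym X A B (m : Mor A X) (n : Mor B X) :
  same_subobject m n -> same_subobject n m.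
Proof. by case. Qed.

End PreadditiveTheory.

Lemma fmap_iso (C D : preaddCat) (F : functor C D) A B (f : Mor A B) :
  is_iso f -> is_iso (fmap F f).
Proof.
by move=> [g [gf fg]]; exists (fmap F g); rewrite -!fmap_comp gf fg !fmap_id.
Qed.

(* Otherwise a nonzero kernel of fbar could be absorbed into k: writing c for
   its cokernel, c ∘ q is a cokernel of some l killed by f, hence by q. *)
Lemma coimage_mono (D : abelianCat) (A B K Q : D) (f : Mor A B)
    (k : Mor K A) (q : Mor A Q) (fbar : Mor Q B) :
  is_kernel f k -> is_cokernel k q -> fbar ∘ q = f -> is_mono fbar.
Proof.
move=> kerk cokq fq.
have eq := cokernel_epi cokq.
suff ker0 Z (z : Mor Z Q) : fbar ∘ z = 0 -> z = 0.
  move=> Z u v e; apply/eqP; rewrite -subr_eq0; apply/eqP/ker0.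
  have e0 : fbar ∘ (u - v) + fbar ∘ v = 0 + fbar ∘ v.
    by rewrite -compmDr subrK add0r.
  exact: addIr e0.
move=> fz; have [Q' [c cokc]] := abelian_coker z.
have ec := cokernel_epi cokc.
have [L [l cokl]] := abelian_epi (comp_epi eq ec).
have [f' f'c] := cokernel_lift cokc fz.
have fl : f ∘ l = 0.
  by rewrite -fq -f'c -2!compmA (compmA c) (proj1 cokl) compm0.
have [m km] := kernel_lift kerk fl.
have ql : q ∘ l = 0 by rewrite -km compmA (proj1 cokq) comp0m.
have [w wcq] := cokernel_lift cokl ql.
have wc : w ∘ c = idm Q by apply: eq; rewrite -compmA wcq compm_idl.
by rewrite -[z]compm_idl -wc -compmA (proj1 cokc) compm0.
Qed.

(** * Short strict exact sequences *)

Section ExactTheory.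
Variable C : exactCat.
Implicit Types A B X Y Z K Q R : C.

Lemma se_kernel A B X (i : Mor A B) (p : Mor B X) :
  strict_exact i p -> is_kernel p i.
Proof. by move/(ex_ker_coker (exactP C)) => []. Qed.

Lemma se_cokernel A B X (i : Mor A B) (p : Mor B X) :
  strict_exact i p -> is_cokernel i p.
Proof. by move/(ex_ker_coker (exactP C)) => []. Qed.

Lemma se_comp0 A B X (i : Mor A B) (p : Mor B X) :
  strict_exact i p -> p ∘ i = 0.
Proof. by move/se_kernel => []. Qed.

Lemma se_mono A B X (i : Mor A B) (p : Mor B X) :
  strict_exact i p -> is_mono i.
Proof. by move/se_kernel/kernel_mono. Qed.

Lemma se_epi A B X (i : Mor A B) (p : Mor B X) :
  strict_exact i p -> is_epi p.
Proof. by move/se_cokernel/cokernel_epi. Qed.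

Lemma strict_is_mono A B (i : Mor A B) : strict_mono i -> is_mono i.
Proof. by move=> [X [p /se_mono]]. Qed.

(** The kernel [i] of the strict epimorphism [idm X] is both zero and a monomorphism, so its source
    is zero. *)
Lemma se_from_zero X :
  exists (Z : C) (i : Mor Z X), is_zero Z /\ strict_exact i (idm X).
Proof.
have [Z [i Eip]] := ex_id_epi (exactP C) X; exists Z, i; split=> //.
apply: mono0_zero (se_mono Eip) _.
by rewrite -[LHS]compm_idl (se_comp0 Eip).
Qed.

Lemma se_to_zero X :
  exists (Z : C) (p : Mor X Z), is_zero Z /\ strict_exact (idm X) p.
Proof.
have [Z [p Eip]] := ex_id_mono (exactP C) X; exists Z, p; split=> //.
apply: epi0_zero (se_epi Eip) _.
by rewrite -[LHS]compm_idr (se_comp0 Eip).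
Qed.

(* K is the pullback of p along k', so K -> K' is a strict epimorphism whose
   kernel factors through S: K is an extension of K' by S. *)
Lemma se_comp_kernel_vanish S X Y K' R K B (s : Mor S X) (p : Mor X Y)
    (k' : Mor K' Y) (r : Mor Y R) (k : Mor K X) (f : Mor K B) :
  strict_exact s p -> strict_exact k' r -> strict_exact k (r ∘ p) ->
  (forall g : Mor S B, g = 0) -> (forall g : Mor K' B, g = 0) -> f = 0.
Proof.
move=> Esp Ekr Ek vS vK.
have [P [p' [x [[sq univ] [A' [a Eap]]]]]] :
    exists P (p' : Mor P K') (x : Mor P X), is_pullback p k' p' x /\
      adm_epi (@strict_exact C) p'.
  by apply: (ex_pullback (exactP C)); exists S, s.
have px0 : (r ∘ p) ∘ x = 0 by rewrite -compmA -sq compmA (se_comp0 Ekr) comp0m.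
have [g kg] := kernel_lift (se_kernel Ek) px0.
have pk0 : r ∘ (p ∘ k) = 0 by rewrite compmA (se_comp0 Ek).
have [t k't] := kernel_lift (se_kernel Ekr) pk0.
have [h [[_ xh] _]] := univ K t k k't.
have gh : g ∘ h = idm K.
  by apply: (se_mono Ek); rewrite compmA kg xh compm_idr.
have pxa : p ∘ (x ∘ a) = 0.
  by rewrite compmA -sq -compmA (se_comp0 Eap) compm0.
have [w sw] := kernel_lift (se_kernel Esp) pxa.
have rps : (r ∘ p) ∘ s = 0 by rewrite -compmA (se_comp0 Esp) compm0.
have [v kv] := kernel_lift (se_kernel Ek) rps.
have ga : g ∘ a = v ∘ w.
  by apply: (se_mono Ek); rewrite !compmA kg kv sw.
(* As [f = f ∘ g ∘ h], it is enough to kill [f ∘ g]. It vanishes on the kernel [a] of [p'], hence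
   factors through [K']. *)
have fga : (f ∘ g) ∘ a = 0 by rewrite -compmA ga compmA (vS (f ∘ v)) comp0m.
have [u up] := cokernel_lift (se_cokernel Eap) fga.
by rewrite -[f]compm_idr -gh compmA -up (vK u) !comp0m.
Qed.

End ExactTheory.

(** * Slopes and semistable objects *)

Section HN.
Variables (V : orderedGroupType) (C : exactCat) (D : abelianCat)
  (F : functor C D) (rk : D -> nat) (deg : C -> V).
Hypotheses
  (rk_iso : forall A B : D, isomorphic A B -> rk A = rk B)
  (deg_iso : forall A B : C, isomorphic A B -> deg A = deg B)
  (F_exact : exact_functor F)
  (F_faithful : faithful_functor F)
  (F_strict_sub : forall X : C, strict_sub_bijection F X)
  (rk_add : forall (A B X : D) (i : Mor A B) (p : Mor B X),
     ker_coker_pair i p -> rk B = (rk A + rk X)%N)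
  (rk_eq0 : forall A : D, rk A = 0%N <-> is_zero A)
  (deg_add : forall (A B X : C) (i : Mor A B) (p : Mor B X),
     strict_exact i p -> deg B = deg A + deg X)
  (deg_le : forall (X Y : C) (f : Mor X Y), is_iso (fmap F f) ->
     deg X <= deg Y /\ (deg X = deg Y <-> is_iso f)).
Implicit Types A B X Y Z K Q R S : C.
Local Notation mu := (slope F rk deg).
Local Notation rkF X := (rk (F X)).

(** * Zero objects, ranks and degrees under the functor *)

(** A [functor] is not additive by definition, so this is drawn from exactness: the image of the
    sequence A = A -> Z with Z zero shows that [F Z] is zero, and a zero map factors through Z. *)
Lemma fmap0 A B : fmap F (0 : Mor A B) = 0.
Proof.
have [Z [p [_ Ep]]] := se_to_zero A.
have [kerFp cokFp] := F_exact Ep.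
have Fp0 : fmap F p = 0.
  by rewrite -[fmap F p]compm_idr -fmap_id (proj1 kerFp).
have FZ0 := epi0_zero (cokernel_epi cokFp) Fp0.
rewrite -[0 : Mor A B](comp0m B p) fmap_comp.
by rewrite (mor_from_zero (fmap F (0 : Mor Z B)) FZ0) comp0m.
Qed.

Lemma fmap_eq0 A B (f : Mor A B) : fmap F f = 0 -> f = 0.
Proof. by move=> Ff0; apply: F_faithful; rewrite Ff0 fmap0. Qed.

Lemma is_zero_fobj X : is_zero (F X) <-> is_zero X.
Proof.
split=> /is_zeroP h; apply/is_zeroP; first by apply: fmap_eq0; rewrite fmap_id.
by rewrite -fmap_id h fmap0.
Qed.

Lemma rkF_eq0 X : rkF X = 0%N <-> is_zero X.
Proof. by rewrite rk_eq0; apply: is_zero_fobj. Qed.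

Lemma rkF_gt0 X : ~ is_zero X -> (0 < rkF X)%N.
Proof. by move=> X0; rewrite lt0n; apply/eqP=> /rkF_eq0. Qed.

Lemma rkF_add A B X (i : Mor A B) (p : Mor B X) :
  strict_exact i p -> rkF B = (rkF A + rkF X)%N.
Proof. by move/F_exact/rk_add. Qed.

Lemma rkF_iso A B (f : Mor A B) : is_iso (fmap F f) -> rkF A = rkF B.
Proof. by move=> isof; apply: rk_iso; exists (fmap F f). Qed.

(** The sequence X = X -> Z with Z zero gives deg X = deg X + deg Z, and X is isomorphic to Z. *)
Lemma deg_zero X : is_zero X -> deg X = 0.
Proof.
move=> X0; have [Z [p [Z0 Ep]]] := se_to_zero X.
have -> : deg X = deg Z.
  apply: deg_iso; exists 0, 0.
  by move/is_zeroP: X0 => ->; move/is_zeroP: Z0 => ->; rewrite !comp0m.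
by apply: (@addrI _ (deg X)); rewrite addr0 -(deg_add Ep).
Qed.

(** * Comparison of slopes *)

Lemma slope_le X Y : ~ is_zero X -> ~ is_zero Y ->
  (mu X <= mu Y) = (deg X *+ rkF Y <= deg Y *+ rkF X).
Proof.
by move=> X0 Y0; rewrite /slope !tens_invn ?le_fracQ //; apply: rkF_gt0.
Qed.

Lemma slope_eq X Y : deg X = deg Y -> rkF X = rkF Y -> mu X = mu Y.
Proof. by rewrite /slope => -> ->. Qed.

Lemma slope_iso X Y (f : Mor X Y) : is_iso f -> mu X = mu Y.
Proof.
move=> isof; apply: slope_eq; first by apply: deg_iso; exists f.
exact: rkF_iso (fmap_iso F isof).
Qed.

Lemma slope_le_fmap_iso X Y (f : Mor X Y) :
  is_iso (fmap F f) -> mu X <= mu Y.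
Proof.
(* For zero objects both slopes are the same junk value; otherwise the ranks agree and only the
   degrees are compared. *)
move=> isof; have [X0|X0] := classic (is_zero X).
  have Y0 : is_zero Y by apply/rkF_eq0; rewrite -(rkF_iso isof); apply/rkF_eq0.
  by rewrite (slope_eq (Y := Y)) ?deg_zero ?(rkF_iso isof).
have Y0 : ~ is_zero Y by move/rkF_eq0; rewrite -(rkF_iso isof) => /rkF_eq0.
rewrite slope_le // -(rkF_iso isof) og_leMn ?rkF_gt0 //.
by case: (deg_le isof).
Qed.

(** After clearing denominators and cancelling, both sides become deg A * rk X <= deg X * rk A. *)
Lemma seesaw_le A B X (i : Mor A B) (p : Mor B X) :
  strict_exact i p -> ~ is_zero A -> ~ is_zero X ->
  (mu A <= mu B) = (mu B <= mu X).
Proof.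
move=> E A0 X0.
have B0 : ~ is_zero B.
  by move=> B0; apply/A0/(mono0_zero (se_mono E))/mor_to_zero.
rewrite !slope_le // (rkF_add E) (deg_add E) !mulrnDr !mulrnDl.
by rewrite og_leD2lE [X in _ = (_ <= X)]addrC [X in _ = (X <= _)]addrC og_leD2lE.
Qed.

Lemma slope_quot_zero A B X (i : Mor A B) (p : Mor B X) :
  strict_exact i p -> is_zero A -> mu B = mu X.
Proof.
move=> E A0; apply: slope_eq; first by rewrite (deg_add E) (deg_zero A0) add0r.
by rewrite (rkF_add E) (proj2 (rkF_eq0 A) A0).
Qed.

Lemma slope_sub_full A B X (i : Mor A B) (p : Mor B X) :
  strict_exact i p -> is_zero X -> mu A = mu B.
Proof.
move=> E X0; apply: slope_eq; first by rewrite (deg_add E) (deg_zero X0) addr0.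
by rewrite (rkF_add E) (proj2 (rkF_eq0 X) X0) addn0.
Qed.

(** The strict subobject K of A corresponds to the kernel of [fmap F f], and Q is A/K. By
    [coimage_mono], F(Q) is a subobject of F(B), and I is the strict subobject of B that corresponds
    to it. *)
Lemma coimage_image A B (f : Mor A B) :
  exists K (k : Mor K A) Q (q : Mor A Q) I (i : Mor I B) (h : Mor Q I),
    [/\ strict_exact k q, strict_mono i, is_iso (fmap F h) & f = i ∘ h ∘ q].
Proof.
have [K0 [k0 kerk0]] := abelian_ker (fmap F f).
have [[K k mk] /= [Q [q Ekq]] [[u k0u] [v kv]]] :=
  proj2 (F_strict_sub A) (Subobject (kernel_mono kerk0)).
rewrite /= in k0u kv.
have fk : f ∘ k = 0.
  by apply: fmap_eq0; rewrite fmap_comp -k0u compmA (proj1 kerk0) comp0m.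
have [fbar fbarq] := cokernel_lift (se_cokernel Ekq) fk.
have [kerFq cokFk] := F_exact Ekq.
have Ffbarq : fmap F fbar ∘ fmap F q = fmap F f by rewrite -fmap_comp fbarq.
have kerFk : is_kernel (fmap F f) (fmap F k).
  split=> [|Z t ft]; first by rewrite -fmap_comp fk fmap0.
  have [w kw] := kernel_lift kerk0 ft.
  by apply: (proj2 kerFq); rewrite -kw -kv !compmA (proj1 kerFq) !comp0m.
have mF := coimage_mono kerFk cokFk Ffbarq.
have [[I i mi] /= [R [r Eir]] [le_i le_F]] :=
  proj2 (F_strict_sub B) (Subobject mF).
rewrite /= in le_i le_F.
(* [fmap F fbar] factors through [fmap F i], so the composite vanishes after F, and F is
   faithful. *)
have rf : r ∘ fbar = 0.
  have [w iw] := le_F.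
  by apply: fmap_eq0; rewrite fmap_comp -iw compmA -fmap_comp
    (se_comp0 Eir) fmap0 comp0m.
have [h ih] := kernel_lift (se_kernel Eir) rf.
exists K, k, Q, q, I, i, h; split=> //; last by rewrite ih fbarq.
  by exists R, r.
apply: factor_iso mF _ _ le_i; last by rewrite -fmap_comp ih.
exact: kernel_mono (proj1 (F_exact Eir)).
Qed.

(** * Semistable objects and maps between them *)

Lemma semistable_sub X (s : subobject X) :
  semistable mu X -> ~ is_zero s -> mu s <= mu X.
Proof.
move=> [_ ssX] s0; have [isos|] := classic (is_iso (sub_arr s)).
  by rewrite (slope_iso isos).
exact: ssX.
Qed.

Lemma semistable_quot K X Q (k : Mor K X) (q : Mor X Q) :
  semistable mu X -> strict_exact k q -> ~ is_zero Q -> mu X <= mu Q.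
Proof.
move=> ssX Ekq Q0; have [K0|K0] := classic (is_zero K).
  by rewrite (slope_quot_zero Ekq K0).
rewrite -(seesaw_le Ekq) //.
exact: (@semistable_sub _ (Subobject (se_mono Ekq))).
Qed.

(** If the coimage Q is nonzero, then mu A <= mu Q <= mu I <= mu B, where I is the strict image. *)
Lemma hom_semistable_eq0 A B (f : Mor A B) :
  semistable mu A -> semistable mu B -> mu B < mu A -> f = 0.
Proof.
move=> ssA ssB lt_BA.
have [K [k [Q [q [I [i [h [Ekq si isoh ->]]]]]]]] := coimage_image f.
have [Q0|Q0] := classic (is_zero Q).
  by rewrite (mor_to_zero q Q0) compm0.
have I0 : ~ is_zero I by move/rkF_eq0; rewrite -(rkF_iso isoh) => /rkF_eq0.
have := lt_le_trans lt_BA (semistable_quot ssA Ekq Q0).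
rewrite ltNge (le_trans (slope_le_fmap_iso isoh)) //.
exact: (@semistable_sub _ (Subobject (strict_is_mono si))).
Qed.

(** * Destabilizing subobjects and the last quotient *)

(** Semistability tests all subobjects, but the strict image of a destabilizing one has at least its
    slope: the coimage of a monomorphism is its source up to a zero kernel. *)
Lemma strict_destabilizing X : ~ is_zero X -> ~ semistable mu X ->
  exists S (s : Mor S X), [/\ strict_mono s, ~ is_zero S & mu X < mu S].
Proof.
move=> X0 nssX; apply: NNPP => noS; apply: nssX; split=> // s s0 _.
rewrite leNgt; apply/negP=> lt_Xs; apply: noS.
have [K [k [Q [q [I [i [h [Ekq si isoh e]]]]]]]] := coimage_image (sub_arr s).
have K0 : is_zero K.
  apply: mono0_zero (se_mono Ekq) _; apply: (@sub_mono _ _ s).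
  by rewrite compm0 e -!compmA (se_comp0 Ekq) !compm0.
exists I, i; split=> //.
  move/rkF_eq0; rewrite -(rkF_iso isoh) => /rkF_eq0 Q0.
  by apply/s0/(mono0_zero (@sub_mono _ _ s)); rewrite e (mor_to_zero q Q0) compm0.
apply: lt_le_trans lt_Xs _; rewrite (slope_quot_zero Ekq K0).
exact: slope_le_fmap_iso isoh.
Qed.

(** Take R of minimal rank among the nonzero strict quotients of slope at most mu X. A strict S
    destabilizing R would give R/S, of smaller rank and, by the seesaw, of slope at most mu R. *)
Lemma semistable_quotient X : ~ is_zero X ->
  exists K (k : Mor K X) R (r : Mor X R),
    [/\ strict_exact k r, semistable mu R & mu R <= mu X].
Proof.
move=> X0.
pose P (R : {R : C & Mor X R}) := [/\ adm_epi (@strict_exact C) (projT2 R),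
  ~ is_zero (projT1 R) & mu (projT1 R) <= mu X].
have [|[R r] [[K [k Ekr]] R0 le_R] min_R] :=
  @exists_minimal _ (fun T => rkF (projT1 T)) P.
  exists (existT _ X (idm X)); split=> //.
  exact: (ex_id_epi (exactP C)).
simpl in *.
exists K, k, R, r; split=> //; apply: NNPP => nssR.
have [S [s [[R' [r' E']] S0 lt_RS]]] := strict_destabilizing R0 nssR.
have [R'0|R'0] := classic (is_zero R').
  by rewrite (slope_sub_full E' R'0) ltxx in lt_RS.
have [|] := negP (_ : ~~ (rkF R <= rkF R')%N).
  by rewrite -ltnNge (rkF_add E') -[X in (X < _)%N]add0n ltn_add2r rkF_gt0.
apply: (min_R (existT _ R' (r' ∘ r))); split=> //=.
  by apply: (ex_comp_epi (exactP C)); [exists K, k | exists S, s].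
apply: le_trans le_R; rewrite leNgt; apply/negP=> lt_R.
by move: lt_RS; rewrite ltNge (seesaw_le E') ?(ltW lt_R).
Qed.

(* The torsion class of the objects all of whose Harder-Narasimhan slopes
   exceed t. *)
Definition hn_above (t : tensQ V) X :=
  forall B (f : Mor X B), semistable mu B -> mu B <= t -> f = 0.

(** Take S of minimal rank. A nonzero map from S to a semistable B with mu B <= mu X has a coimage
    of slope below mu S, so by the seesaw its kernel has slope above mu S; this kernel destabilizes
    X and has smaller rank. *)
Lemma hn_above_destabilizing X : ~ is_zero X -> ~ semistable mu X ->
  exists S (s : Mor S X),
    [/\ strict_mono s, ~ is_zero S, mu X < mu S & hn_above (mu X) S].
Proof.
move=> X0 nssX.
pose P (S : {S : C & Mor S X}) :=
  [/\ strict_mono (projT2 S), ~ is_zero (projT1 S) & mu X < mu (projT1 S)].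
have [|[S s] [ss S0 lt_S] min_S] :=
  @exists_minimal _ (fun T => rkF (projT1 T)) P.
  have [S [s [ss S0 lt_S]]] := strict_destabilizing X0 nssX.
  by exists (existT _ S s).
simpl in *.
exists S, s; split=> // B f ssB le_B.
have [K [k [Q [q [I [i [h [Ekq si isoh ->]]]]]]]] := coimage_image f.
have [Q0|Q0] := classic (is_zero Q).
  by rewrite (mor_to_zero q Q0) compm0.
have I0 : ~ is_zero I by move/rkF_eq0; rewrite -(rkF_iso isoh) => /rkF_eq0.
have lt_QS : mu Q < mu S.
  apply: le_lt_trans lt_S; apply: le_trans (slope_le_fmap_iso isoh) _.
  apply: le_trans le_B.
  exact: (@semistable_sub _ (Subobject (strict_is_mono si))).
have [K0|K0] := classic (is_zero K).
  by rewrite (slope_quot_zero Ekq K0) ltxx in lt_QS.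
have lt_SK : mu S < mu K by rewrite ltNge (seesaw_le Ekq) // -ltNge.
have [|] := negP (_ : ~~ (rkF S <= rkF K)%N).
  by rewrite -ltnNge (rkF_add Ekq) -[X in (X < _)%N]addn0 ltn_add2l rkF_gt0.
apply: (min_S (existT _ K (s ∘ k))); split=> //=; last exact: lt_trans lt_SK.
by apply: (ex_comp_mono (exactP C)) => //; exists Q, q.
Qed.

(** Induction on the rank, applied to Y = X/S for S as in [hn_above_destabilizing]: the last
    quotient R of Y also serves for X, since the kernel of X -> R is an extension of K' by S. *)
Lemma hn_last_quotient X : ~ is_zero X ->
  exists K (k : Mor K X) R (r : Mor X R),
    [/\ strict_exact k r, semistable mu R & hn_above (mu R) K].
Proof.
have [n] := ubnP (rkF X); elim: n X => // n IHn X lt_Xn X0.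
have [ssX|nssX] := classic (semistable mu X).
  have [K [k [K0 Ek]]] := se_from_zero X.
  by exists K, k, X, (idm X); split=> // B f _ _; apply: mor_from_zero.
have [S [s [[Y [p Esp]] S0 lt_S aS]]] := hn_above_destabilizing X0 nssX.
have Y0 : ~ is_zero Y.
  by move=> Y0; rewrite (slope_sub_full Esp Y0) ltxx in lt_S.
have [|K' [k' [R [r [Ekr ssR aK']]]]] := IHn Y _ Y0.
  rewrite -ltnS (leq_trans _ lt_Xn) // ltnS (rkF_add Esp).
  by rewrite -[X in (X < _)%N]add0n ltn_add2r rkF_gt0.
(* This puts S in [hn_above (mu R)]. If mu X < mu R, a semistable quotient B of X with mu B <= mu X
   receives only zero maps from S, K' and R in turn, so X -> B is zero and B is zero. *)
have le_RX : mu R <= mu X.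
  rewrite leNgt; apply/negP=> lt_XR.
  have [K2 [k2 [B [b [Eb ssB le_B]]]]] := semistable_quotient X0.
  apply: (proj1 ssB); apply: (epi0_zero (se_epi Eb)).
  have [b' <-] := cokernel_lift (se_cokernel Esp) (aS _ (b ∘ s) ssB le_B).
  have bk : b' ∘ k' = 0 by apply: aK' => //; apply: le_trans le_B (ltW lt_XR).
  have [b'' <-] := cokernel_lift (se_cokernel Ekr) bk.
  by rewrite (hom_semistable_eq0 b'') ?(le_lt_trans le_B) ?comp0m.
have [K [k Ek]] : adm_epi (@strict_exact C) (r ∘ p).
  by apply: (ex_comp_epi (exactP C)); [exists S, s | exists K', k'].
exists K, k, R, (r ∘ p); split=> // B f ssB le_B.
apply: (se_comp_kernel_vanish f Esp Ekr Ek) => g; last exact: aK'.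
by apply: aS ssB (le_trans le_B le_RX).
Qed.

(** * Harder-Narasimhan filtrations *)

Definition sub_comp K X (k : Mor K X) (mk : is_mono k) (s : subobject K) :
    subobject X :=
  Subobject (comp_mono (@sub_mono _ _ s) mk).

(** The filtration of length 0 starts the induction: the kernel of the last quotient may be zero. *)
Lemma HN_zero X : is_zero X -> inhabited (HN_filtration mu X).
Proof.
move=> X0; constructor.
pose X1 := Subobject (@idm_mono _ X).
apply: (@HNFiltration _ _ mu X 0%N (fun _ => X1) (fun _ => X)) => //.
- by move=> i _; apply: (ex_id_mono (exactP C)).
- exact: is_iso_idm.
- by case.
by move=> i; rewrite ltn0 andbF.
Qed.

(** The steps of [H] are composed with [k], and X is added on top with graded piece R. The slope
    condition is guarded because [H] may have length 0. *)
Lemma HN_append K X R (k : Mor K X) (r : Mor X R) (H : HN_filtration mu K) :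
  strict_exact k r -> semistable mu R ->
  ((0 < hn_len H)%N -> mu R < mu (hn_gr H (hn_len H))) ->
  inhabited (HN_filtration mu X).
Proof.
move=> Ekr ssR lt_R; constructor; set N := hn_len H in lt_R *.
have mk := se_mono Ekr.
pose fil i :=
  if (i <= N)%N then sub_comp mk (hn_fil H i) else Subobject (@idm_mono _ X).
pose gr i := if (i <= N)%N then hn_gr H i else R.
have filE i : (i <= N)%N -> fil i = sub_comp mk (hn_fil H i).
  by rewrite /fil => ->.
have filT : fil N.+1 = Subobject (@idm_mono _ X) by rewrite /fil ltnn.
have grE i : (i <= N)%N -> gr i = hn_gr H i by rewrite /gr => ->.
have grT : gr N.+1 = R by rewrite /gr ltnn.
apply: (@HNFiltration _ _ mu X N.+1 fil gr).
- move=> i; rewrite leq_eqVlt => /predU1P[->|le_iN].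
    by rewrite filT; apply: (ex_id_mono (exactP C)).
  rewrite filE //; apply: (ex_comp_mono (exactP C)); first exact: hn_strict.
  by exists R, r.
- by rewrite filE //; apply: hn_bot.
- by rewrite filT; apply: is_iso_idm.
- move=> i; rewrite ltnS leq_eqVlt => /predU1P[->|lt_iN].
    rewrite filT filE //; split.
      by exists (k ∘ sub_arr (hn_fil H N)); rewrite /= compm_idl.
    (* If step N were all of X, then [idm X] would factor through [k], and [r] would vanish. *)
    move=> [_ [u /= e]]; apply/(proj1 ssR)/(epi0_zero (se_epi Ekr)).
    by rewrite -[r]compm_idr -e !compmA (se_comp0 Ekr) !comp0m.
  rewrite !filE ?(ltnW lt_iN) //; have [[u eu] neq] := hn_lt lt_iN; split.
    by exists u; rewrite /= -eu compmA.
  move=> [_ [v /= ev]]; apply: neq; split; first by exists u.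
  by exists v; apply: (se_mono Ekr); rewrite compmA.
- move=> i; rewrite ltnS leq_eqVlt => /predU1P[->|lt_iN].
    rewrite filT filE // grT.
    exists (k ∘ sub_arr (hn_fil H N)), r; split; first by rewrite /= compm_idl.
    (* The top step of [H] is only isomorphic to K, so [Ekr] is transported along the inverse [g] of
       its inclusion. *)
    have [g [gs sg]] := hn_top H.
    apply: (ex_iso (exactP C) (a := g) _ (is_iso_idm X) (is_iso_idm R) _ _ Ekr).
    - by exists (sub_arr (hn_fil H N)).
    - by rewrite -compmA sg compm_idr compm_idl.
    - by rewrite compm_idr compm_idl.
  rewrite !filE ?(ltnW lt_iN) // grE //.
  have [j [p [ej Ejp]]] := hn_quot lt_iN.
  by exists j, p; split=> //=; rewrite -compmA ej.
- move=> i /andP[i0]; rewrite leq_eqVlt => /predU1P[->|le_iN].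
    by rewrite grT.
  by rewrite grE //; apply: hn_semistable; rewrite i0.
move=> i /andP[i0]; rewrite ltnS leq_eqVlt => /predU1P[eiN|lt_iN].
  by rewrite eiN grT grE //; apply: lt_R; rewrite -eiN.
by rewrite !grE ?(ltnW lt_iN) //; apply: hn_slope; rewrite i0.
Qed.

Lemma HN_exists X : inhabited (HN_filtration mu X).
Proof.
have [n] := ubnP (rkF X); elim: n X => // n IHn X lt_Xn.
have [X0|X0] := classic (is_zero X); first exact: HN_zero.
have [K [k [R [r [Ekr ssR aK]]]]] := hn_last_quotient X0.
have [|H] := IHn K.
  rewrite -ltnS (leq_trans _ lt_Xn) // ltnS (rkF_add Ekr).
  by rewrite -[X in (X < _)%N]addn0 ltn_add2l rkF_gt0 //; case: ssR.
apply: (HN_append Ekr ssR (H := H)); case eN: (hn_len H) => [//|N] _.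
have lt_N : (N < hn_len H)%N by rewrite eN.
have ssG : semistable mu (hn_gr H N.+1) by apply: hn_semistable.
have [j [p [_ Ejp]]] := hn_quot lt_N.
have [g isog] : exists g : Mor K (hn_fil H N.+1), is_iso g.
  have [g [gs sg]] := hn_top H; rewrite eN in g gs sg.
  by exists g, (sub_arr (hn_fil H N.+1)).
(* The map from K to its last graded piece is a nonzero epimorphism, whereas [aK] would make it zero
   if that slope were at most mu R. *)
rewrite ltNge; apply/negP=> le_R; apply: (proj1 ssG).
apply: (epi0_zero (comp_epi (is_iso_epi isog) (se_epi Ejp))).
exact: aK.
Qed.

(** * Slopes along a filtration and the reindexing *)

Section HNTheory.
Variables (X : C) (H : HN_filtration mu X).

Lemma hn_slope_lt a b : (0 < a < b)%N -> (b <= hn_len H)%N ->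
  mu (hn_gr H b) < mu (hn_gr H a).
Proof.
move=> /andP[a0]; elim: b => // b IHb; rewrite ltnS leq_eqVlt.
case/predU1P=> [<-|lt_ab] le_bN; first by apply: hn_slope; rewrite a0.
by apply: lt_trans (IHb lt_ab (ltnW le_bN)); apply: hn_slope; lia.
Qed.

Lemma hn_slope_le a b : (0 < a <= b)%N -> (b <= hn_len H)%N ->
  mu (hn_gr H b) <= mu (hn_gr H a).
Proof.
move=> /andP[a0]; rewrite leq_eqVlt => /predU1P[->//|lt_ab] le_bN.
by apply/ltW/hn_slope_lt; rewrite ?a0.
Qed.

Lemma hn_len_gt0 : ~ is_zero X -> (0 < hn_len H)%N.
Proof.
move=> X0; rewrite lt0n; apply/eqP=> N0; apply: X0.
have isoT := hn_top H; rewrite N0 in isoT.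
exact: (epi0_zero (is_iso_epi isoT) (mor_from_zero _ (hn_bot H))).
Qed.

(** Functoriality relies on these inequalities alone, which merge the branches of [hn_index]. *)
Lemma hn_index_spec (t : tensQ V) (i := hn_index H t) : ~ is_zero X ->
  [/\ (i <= hn_len H)%N,
      forall a, (0 < a <= i)%N -> t <= mu (hn_gr H a) &
      forall b, (i < b <= hn_len H)%N -> mu (hn_gr H b) < t].
Proof.
move=> X0; rewrite {}/i /hn_index; have N0 := hn_len_gt0 X0.
case: (leP t (mu (hn_gr H (hn_len H)))) => [le_tN|lt_Nt].
  split=> // [a a_le|b]; last by lia.
  by apply: le_trans le_tN _; apply: hn_slope_le.
case: (ltP (mu (hn_gr H 1)) t) => [lt_1t|le_t1].
  split=> // [a|b /andP[b0 le_bN]]; first by lia.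
  by apply: le_lt_trans lt_1t; apply: hn_slope_le; rewrite ?b0.
case: pickP => [i /and3P[i0 lt_it le_ti]|none].
  split=> [|a /andP[a0 le_ai]|b /andP[lt_ib le_bN]]; first exact: ltnW.
    apply: le_trans le_ti _; apply: hn_slope_le; rewrite ?a0 //.
    exact: ltnW.
  by apply: le_lt_trans lt_it; apply: hn_slope_le.
(* If no index is picked, t <= mu_1 propagates from each slope to the next up to mu_N, against mu_N
   < t. *)
suff le_t i : (0 < i <= hn_len H)%N -> t <= mu (hn_gr H i).
  by move: lt_Nt; rewrite ltNge le_t // N0 leqnn.
elim: i => // -[//|i] IHi lt_iN; have := none (Ordinal lt_iN).
by rewrite /= IHi ?(ltnW lt_iN) // andbT => /negbT; rewrite -leNgt.
Qed.

End HNTheory.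

(* Going from (k, l+1) and (k-1, l) to (k, l): the map X_k -> Y_{l+1} sends
   X_{k-1} into Y_l, and so it induces a map between graded pieces, which is
   zero by the assumption on slopes. *)
Lemma hn_fil_factor X Y (HX : HN_filtration mu X) (HY : HN_filtration mu Y)
    (f : Mor X Y) k l :
  (k <= hn_len HX)%N -> (l <= hn_len HY)%N ->
  (forall a b, (0 < a <= k)%N -> (l < b <= hn_len HY)%N ->
     mu (hn_gr HY b) < mu (hn_gr HX a)) ->
  factors_through (f ∘ sub_arr (hn_fil HX k)) (sub_arr (hn_fil HY l)).
Proof.
elim: k l => [|k IHk] l le_k le_l lt_mu.
  by exists 0; rewrite (mor_from_zero (sub_arr _) (hn_bot HX)) !compm0.
(* Descending induction on [l], starting from the top step of [HY], whose inclusion is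
   invertible. *)
have [d] := ubnP (hn_len HY - l); elim: d => // d IHd in l le_l lt_mu *.
move=> lt_d; move: le_l; rewrite leq_eqVlt => /predU1P[->|lt_l].
  have [v [_ sv]] := hn_top HY.
  by exists (v ∘ (f ∘ sub_arr (hn_fil HX k.+1))); rewrite compmA sv compm_idl.
have [a b a_k /andP[lb b_N]||g eg] := IHd l.+1 lt_l.
- by apply: lt_mu; rewrite ?(ltnW lb).
- by lia.
have [j [p [ej Ejp]]] := hn_quot le_k.
have [j' [p' [ej' Ejp']]] := hn_quot lt_l.
have [a b /andP[a0 a_k]|g' eg'] := IHk l (ltnW le_k) (ltnW lt_l).
  by apply: lt_mu; rewrite a0 leqW.
have gj : g ∘ j = j' ∘ g'.
  apply: (@sub_mono _ _ (hn_fil HY l.+1)).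
  by rewrite !compmA eg ej' eg' -compmA ej.
have p'gj : (p' ∘ g) ∘ j = 0.
  by rewrite -compmA gj compmA (se_comp0 Ejp') comp0m.
have [h hp] := cokernel_lift (se_cokernel Ejp) p'gj.
have h0 : h = 0.
  apply: hom_semistable_eq0; try by apply: hn_semistable.
  by apply: lt_mu; rewrite /= ?leqnn ?lt_l.
have p'g : p' ∘ g = 0 by rewrite -hp h0 comp0m.
have [u ju] := kernel_lift (se_kernel Ejp') p'g.
by exists u; rewrite -ej' -compmA ju.
Qed.

(** * Uniqueness of the filtration *)

Lemma hn_fil_le X (H H' : HN_filtration mu X) k l :
  (k <= hn_len H)%N -> (l <= hn_len H')%N ->
  (forall a b, (0 < a <= k)%N -> (l < b <= hn_len H')%N ->
     mu (hn_gr H' b) < mu (hn_gr H a)) ->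
  sub_le (hn_fil H k) (hn_fil H' l).
Proof. by move=> kN lM /(hn_fil_factor (idm X) kN lM); rewrite compm_idl. Qed.

Lemma hn_fil_proper X (H : HN_filtration mu X) i : (i < hn_len H)%N ->
  ~ is_iso (sub_arr (hn_fil H i)).
Proof.
move=> lt_i [v [_ sv]]; have [le_i neq] := hn_lt lt_i; apply: neq.
split=> //; exists (v ∘ sub_arr (hn_fil H i.+1)).
by rewrite compmA sv compm_idl.
Qed.

(* If H and H' agree at step i, then comparing the next slopes both ways shows
   that these are equal, and hence that step i+1 of H lies in that of H'. *)
Lemma hn_next_slope_le X (H H' : HN_filtration mu X) i :
  (i < hn_len H)%N -> (i < hn_len H')%N ->
  sub_eq (hn_fil H i) (hn_fil H' i) ->
  mu (hn_gr H i.+1) <= mu (hn_gr H' i.+1).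
Proof.
(* Otherwise step i+1 of [H] would lie in step i of [H'], hence in step i of [H], which is strictly
   smaller. *)
move=> iN iN' eq_i; rewrite leNgt; apply/negP=> lt_mu.
have [le_i neq] := hn_lt iN; apply: neq; split=> //.
apply: factors_through_trans (proj2 eq_i).
apply: hn_fil_le; rewrite ?(ltnW iN') // => a b a_i /andP[ib bN'].
apply: le_lt_trans (lt_le_trans lt_mu _); first exact: hn_slope_le.
exact: hn_slope_le.
Qed.

Lemma hn_next_le X (H H' : HN_filtration mu X) i :
  (i < hn_len H)%N -> (i < hn_len H')%N ->
  sub_eq (hn_fil H i) (hn_fil H' i) ->
  sub_le (hn_fil H i.+1) (hn_fil H' i.+1).
Proof.
move=> iN iN' eq_i; apply: hn_fil_le => // a b a_i /andP[ib bN'].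
apply: lt_le_trans (hn_slope_le a_i iN).
apply: lt_le_trans (hn_next_slope_le iN' iN (same_subobject_sym eq_i)).
by apply: hn_slope_lt.
Qed.

Lemma hn_fil_eq X (H H' : HN_filtration mu X) i : (i <= hn_len H)%N ->
  (i <= hn_len H')%N /\ sub_eq (hn_fil H i) (hn_fil H' i).
Proof.
elim: i => [|i IHi] iN.
  split=> //; split; exists 0; rewrite compm0; apply/esym/mor_from_zero;
    exact: hn_bot.
have [le_iN' eq_i] := IHi (ltnW iN).
have iN' : (i < hn_len H')%N.
  (* If [H'] ended at i, its step i would be X, and so would step i of [H], which is proper. *)
  rewrite ltn_neqAle le_iN' andbT; apply/eqP=> eN.
  have [w [_ sw]] := hn_top H'; rewrite -eN in w sw.
  have [_ [u eu]] := eq_i; case: (hn_fil_proper iN); exists (u ∘ w).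
  have suw : sub_arr (hn_fil H i) ∘ (u ∘ w) = idm X by rewrite compmA eu.
  split=> //; apply: (@sub_mono _ _ (hn_fil H i)).
  by rewrite compmA suw compm_idl compm_idr.
split=> //; split; first exact: hn_next_le.
by apply: hn_next_le => //; apply: same_subobject_sym.
Qed.

Lemma HN_unique X (H H' : HN_filtration mu X) : same_HN_filtration H H'.
Proof.
split=> [|i /(hn_fil_eq H')[]//].
have [le_N _] := hn_fil_eq H' (leqnn (hn_len H)).
have [le_N' _] := hn_fil_eq H (leqnn (hn_len H')).
by apply/eqP; rewrite eqn_leq le_N.
Qed.

(** * Functoriality of the reindexed filtration *)

(** Slopes of X up to its index are at least t, and slopes of Y beyond its index are below t, so
    [hn_fil_factor] applies. The factorization is unique because the inclusion into Y is a
    monomorphism. *)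
Lemma hn_at_functorial X Y (HX : HN_filtration mu X)
    (HY : HN_filtration mu Y) (f : Mor X Y) (t : tensQ V) :
  ~ is_zero X -> ~ is_zero Y ->
  exists! g : Mor (hn_at HX t) (hn_at HY t),
    sub_arr (hn_at HY t) ∘ g = f ∘ sub_arr (hn_at HX t).
Proof.
move=> X0 Y0; have [iN le_t _] := hn_index_spec HX t X0.
have [jM _ lt_t] := hn_index_spec HY t Y0.
have [|g eg] := hn_fil_factor f iN jM.
  by move=> a b a_i b_j; apply: lt_le_trans (le_t a a_i); apply: lt_t.
exists g; split=> // g' eg'.
by apply: (@sub_mono _ _ (hn_at HY t)); rewrite eg'.
Qed.

End HN.

Theorem mainTheorem2
  (V : orderedGroupType) (C : exactCat) (D : abelianCat) (F : functor C D)
  (rk : D -> nat) (deg : C -> V)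
  (rk_iso : forall A B : D, isomorphic A B -> rk A = rk B)
  (deg_iso : forall A B : C, isomorphic A B -> deg A = deg B)
  (F_exact : exact_functor F)
  (F_faithful : faithful_functor F)
  (F_strict_sub : forall X : C, strict_sub_bijection F X)
  (rk_add : forall (A B X : D) (i : Mor A B) (p : Mor B X),
     ker_coker_pair i p -> rk B = (rk A + rk X)%N)
  (rk_eq0 : forall A : D, rk A = 0%N <-> is_zero A)
  (deg_add : forall (A B X : C) (i : Mor A B) (p : Mor B X),
     strict_exact i p -> deg B = deg A + deg X)
  (deg_le : forall (X Y : C) (f : Mor X Y), is_iso (fmap F f) ->
     deg X <= deg Y /\ (deg X = deg Y <-> is_iso f)) :
  (forall X : C, ~ is_zero X ->
     exists H : HN_filtration (slope F rk deg) X,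
       forall H' : HN_filtration (slope F rk deg) X,
         same_HN_filtration H' H) /\
  (forall (X Y : C)
     (HX : HN_filtration (slope F rk deg) X)
     (HY : HN_filtration (slope F rk deg) Y)
     (f : Mor X Y) (t : tensQ V),
     ~ is_zero X -> ~ is_zero Y ->
     exists! g : Mor (hn_at HX t) (hn_at HY t),
       sub_arr (hn_at HY t) ∘ g = f ∘ sub_arr (hn_at HX t)).
Proof.
split=> [X _|X Y HX HY f t].
  have [H] := HN_exists rk_iso deg_iso F_exact F_faithful F_strict_sub
    rk_add rk_eq0 deg_add deg_le X.
  exists H => H'; exact: (HN_unique rk_iso deg_iso F_exact F_faithful
    F_strict_sub rk_add rk_eq0 deg_add deg_le).
exact: (hn_at_functorial rk_iso deg_iso F_exact F_faithful
  F_strict_sub rk_add rk_eq0 deg_add deg_le).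
Qed.
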